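(* (a) Consider the edge-based protocol on an arbitrary graph $G$ with $n$ nodes and maximum degree $\Delta$, where $\gamma > 1$ is any constant. Then for any round $t$, $\Pr\left[ \max_{w \in V} | x_w^{(t)} - \xi_w^{(t)} | = \mathcal{O}( \sqrt{ \Delta \log n } ) \right] \geq 1 - 2n^{-1}$; and after $\mathcal{O}\left(\frac{\log (Kn)}{1-\lambda(\mathbf{P})}\right)$ rounds the discrepancy is at most $\mathcal{O}( \sqrt{\Delta \log n})$ with probability at least $1-n^{-1}$. (b) Consider the vertex-based protocol on a $d$-regular graph $G$. Then for any round $t$, $\Pr\left[ \max_{w \in V} | x_w^{(t)} - \xi_w^{(t)} | = \mathcal{O}( d^2 \sqrt{\log n} )\right] \geq 1 - 2n^{-1}$; and after $\mathcal{O}\left(\frac{\log (Kn)}{1-\lambda(\mathbf{P})}\right)$ rounds the discrepancy is at most $\mathcal{O}( d^{2} \sqrt{\log n})$ with probability at least $1-n^{-1}$.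
   Context: $G=(V,E)$ is connected, $K$ is the discrepancy $\max_{u,v}|x^{(0)}_u-x^{(0)}_v|$ of the initial integer load vector. Diffusion matrix $\mathbf{P}=\mathbf{P}(\gamma)$: $\mathbf{P}_{u,v}=\frac{1}{\gamma\Delta}$ for $\{u,v\}\in E$, $\mathbf{P}_{u,u}=1-\frac{\deg(u)}{\gamma\Delta}$, $0$ otherwise; $\lambda(\mathbf{P})=\max\{|\lambda_2(\mathbf{P})|,|\lambda_n(\mathbf{P})|\}$. The continuous process is $\xi^{(t)}=\xi^{(t-1)}\mathbf{P}$ with $\xi^{(0)}=x^{(0)}$. Edge-based protocol: in each round, for every edge $\{u,v\}$, the amount of load the continuous diffusion would send along the edge given the current discrete loads, $y=(x^{(t-1)}_u-x^{(t-1)}_v)/(\gamma\Delta)$, is randomly rounded to $\lceil y\rceil$ with probability $y-\lfloor y\rfloor$ and to $\lfloor y\rfloor$ otherwise (so the rounding error has mean $0$), independently over edges, and that integer number of tokens is sent from $u$ to $v$. Vertex-based protocol (with $\gamma=1+1/d$, i.e. $\Delta=d$): in each round every node $u$ sends $\lfloor x^{(t-1)}_u/(d+1)\rfloor$ tokens to each neighbor and keeps the same amount, and the remaining $x^{(t-1)}_u-(d+1)\lfloor x^{(t-1)}_u/(d+1)\rfloor$ tokens are distributed uniformly at random without replacement among $u$ and its $d$ neighbors (at most one per node). *)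

(* Defs.v *)
From HB Require Import structures.
From mathcomp Require Import all_boot all_order all_algebra.
From mathcomp Require Import all_classical all_reals all_analysis.
Set Implicit Arguments. Unset Strict Implicit. Unset Printing Implicit Defensive.
Import Order.TTheory GRing.Theory Num.Theory.
Local Open Scope ring_scope.

Section Diffusion.
Variable R : realType.
Variable n : nat.
Variable e : rel 'I_n.

Definition graph_connected : Prop := forall u v : 'I_n, connect e u v.

Definition deg (u : 'I_n) : nat := #|[set v | e u v]|.
Definition maxdeg : nat := (\max_(u : 'I_n) deg u)%N.
Definition regular (d : nat) : Prop := forall u : 'I_n, deg u = d.

Definition cnbhd (u : 'I_n) : {set 'I_n} := [set v | (v == u) || e u v].

Definition disc (x : 'I_n -> int) : int :=
  \big[Num.max/0]_(u : 'I_n) \big[Num.max/0]_(v : 'I_n) `|x u - x v|.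

Definition maxdev (x : 'I_n -> int) (xi : 'rV[R]_n) : R :=
  \big[Num.max/0]_(w : 'I_n) `|(x w)%:~R - xi 0 w|.

Definition Pmat (gamma Delta : R) : 'M[R]_n :=
  \matrix_(u, v) (if e u v then (gamma * Delta)^-1
                  else if u == v then 1 - (deg u)%:R / (gamma * Delta) else 0).

(* lambda(P) = max(|lambda_2|, |lambda_n|) computed from the eigenvalues
   listed in non-increasing order (with multiplicity) *)
Definition lam_of (s : seq R) : R := Num.max `|nth 0 s 1| `|last 0 s|.
Definition sorted_spectrum (M : 'M[R]_n) (s : seq R) : Prop :=
  sorted (fun a b => b <= a) s /\ char_poly M = \prod_(m <- s) ('X - m%:P).

Fixpoint xi (P : 'M[R]_n) (x0 : 'I_n -> int) (t : nat) : 'rV[R]_n :=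
  match t with
  | 0 => \row_u (x0 u)%:~R
  | t'.+1 => xi P x0 t' *m P
  end.

Definition oedge (p : 'I_n * 'I_n) : bool := e p.1 p.2 && (p.1 < p.2)%N.

Definition yval (gamma : R) (x : 'I_n -> int) (p : 'I_n * 'I_n) : R :=
  (x p.1 - x p.2)%:~R / (gamma * (maxdeg)%:R).

Definition qup (gamma : R) (x : 'I_n -> int) (p : 'I_n * 'I_n) : R :=
  if oedge p then yval gamma x p - (Num.floor (yval gamma x p))%:~R else 0.

Definition eflow (gamma : R) (x : 'I_n -> int) (om : {ffun 'I_n * 'I_n -> bool})
  (p : 'I_n * 'I_n) : int := Num.floor (yval gamma x p) + (om p : nat)%:Z.

Definition estep (gamma : R) (x : 'I_n -> int) (om : {ffun 'I_n * 'I_n -> bool})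
  (u : 'I_n) : int :=
  x u - (\sum_(v | oedge (u, v)) eflow gamma x om (u, v))
      + (\sum_(v | oedge (v, u)) eflow gamma x om (v, u)).

Definition eweight (gamma : R) (x : 'I_n -> int) (om : {ffun 'I_n * 'I_n -> bool}) : R :=
  \prod_(p : 'I_n * 'I_n) (if om p then qup gamma x p else 1 - qup gamma x p).

(* edge_exp gamma x0 t f = E[f(x^(t))] *)
Fixpoint edge_exp (gamma : R) (x0 : 'I_n -> int) (t : nat)
  (f : ('I_n -> int) -> R) : R :=
  match t with
  | 0 => f x0
  | t'.+1 => edge_exp gamma x0 t'
      (fun x => \sum_(om : {ffun 'I_n * 'I_n -> bool})
                  eweight gamma x om * f (estep gamma x om))
  end.

Definition edge_prob (gamma : R) (x0 : 'I_n -> int) (t : nat)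
  (A : pred ('I_n -> int)) : R :=
  edge_exp gamma x0 t (fun x => if A x then 1 else 0).

(* ---------- vertex-based protocol (d-regular, gamma = 1 + 1/d) ---------- *)
Definition rem (d : nat) (x : 'I_n -> int) (u : 'I_n) : nat :=
  absz (x u %% (d.+1)%:Z)%Z.

(* om u = the set of nodes in N[u] receiving one of the remaining tokens of u;
   uniform over subsets of N[u] of size rem, independently over u *)
Definition vweight (d : nat) (x : 'I_n -> int) (om : {ffun 'I_n -> {set 'I_n}}) : R :=
  \prod_(u : 'I_n)
    (if (om u \subset cnbhd u) && (#|om u| == rem d x u)
     then ('C(d.+1, rem d x u))%:R^-1 else 0).

Definition vstep (d : nat) (x : 'I_n -> int) (om : {ffun 'I_n -> {set 'I_n}})
  (w : 'I_n) : int :=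
  (\sum_(u | w \in cnbhd u) (x u %/ (d.+1)%:Z)%Z) + (#|[set u | w \in om u]|)%:Z.

Fixpoint vertex_exp (d : nat) (x0 : 'I_n -> int) (t : nat)
  (f : ('I_n -> int) -> R) : R :=
  match t with
  | 0 => f x0
  | t'.+1 => vertex_exp d x0 t'
      (fun x => \sum_(om : {ffun 'I_n -> {set 'I_n}})
                  vweight d x om * f (vstep d x om))
  end.

Definition vertex_prob (d : nat) (x0 : 'I_n -> int) (t : nat)
  (A : pred ('I_n -> int)) : R :=
  vertex_exp d x0 t (fun x => if A x then 1 else 0).

End Diffusion.

(* Main.v *)
(** Write [x] for the discrete loads, [xi] for the continuous ones and [z_s = P^s e_w].  The
    deviation [x_w - xi_w] after [t] rounds is a sum of rounding errors tested against the
    vectors [z_s], [s < t].  In one round the errors are independent and centered, so the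
    exponential moment of their pairing with [z] is controlled by the Dirichlet energy of [z] over
    the edges (times [d] for the vertex protocol, by Cauchy-Schwarz over the neighbors).  For
    [gamma > 1] the energy of [z] is at most [gamma^2 Delta / (gamma - 1)] times
    [|z|^2 - |P z|^2], so the energies of the [z_s] telescope to [O(Delta)]; a Chernoff bound and a
    union bound over the nodes give the deviation estimate.

    For the discrepancy, [sum_{u,v} (P^t_{uv} - 1/n)^2 = tr P^{2t} - 1] is the sum of [m^{2t}] over
    the eigenvalues [m] other than one copy of [1].  The Poincare inequality of the connected graph
    makes this quantity decay, which forces those eigenvalues into (-1, 1); it is then at most
    [n lambda^{2t}], so [xi] is flat up to a constant after [2 log (K n) / (1 - lambda)] rounds. *)

Require Import Defs.
From HB Require Import structures.
From mathcomp Require Import all_boot all_order all_algebra.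
From mathcomp Require Import all_classical all_reals all_analysis.
From mathcomp Require Import ring lra.
From mathcomp Require Import complex.
Import Order.TTheory GRing.Theory Num.Theory.
Local Open Scope ring_scope.

(** * Concentration for Markov chains with sub-Gaussian steps *)

(** For [y >= 1/2] the exponent [2 y^2] dominates [y]; for smaller [y],
    [expR y <= 1/(1 - y) <= 1 + y + 2 y^2]. The bare [y] on the right averages to zero for a
    centered variable. *)
Lemma expR_le_add_sqr {R : realType} (y : R) : expR y <= y + expR (2 * y ^+ 2).
Proof.
have sq := expR_ge1Dx (2 * y ^+ 2).
case: (leP (1 / 2) y) => hy.
  have : expR y <= expR (2 * y ^+ 2) by rewrite ler_expR; nra.
  lra.
have := expR_ge1Dx (- y); rewrite expRN => h.
have : expR y * (1 - y) <= 1.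
  by rewrite mulrC -ler_pdivlMr ?expR_gt0 // div1r.
nra.
Qed.

(** Hoeffding's lemma with a cruder constant: averaging [expR_le_add_sqr] removes the linear
    term. *)
Lemma mgf_centered {R : realType} {T : finType} (w Y : T -> R) (a : R) :
  (forall i, 0 <= w i) -> \sum_i w i = 1 -> \sum_i w i * Y i = 0 ->
  (forall i, w i != 0 -> `|Y i| <= a) ->
  \sum_i w i * expR (Y i) <= expR (2 * a ^+ 2).
Proof.
move=> w0 w1 wY Ya.
have -> : expR (2 * a ^+ 2) = \sum_i w i * (Y i + expR (2 * a ^+ 2)).
  under eq_bigr do rewrite mulrDr.
  by rewrite big_split /= wY -mulr_suml w1 add0r mul1r.
apply: ler_sum => i _; have [->|wi] := eqVneq (w i) 0; first by rewrite !mul0r.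
apply: ler_wpM2l => //; apply: le_trans (expR_le_add_sqr _) _.
rewrite lerD2l ler_expR ler_pM2l // -(real_normK (num_real (Y i))).
by rewrite lerXn2r ?nnegrE ?Ya // (le_trans _ (Ya i wi)).
Qed.

(** Cauchy-Schwarz, from the nonnegativity of the squared deviations of [f] from its mean over
    [A]. *)
Lemma sqr_sum_le {R : realFieldType} {T : finType} (A : pred T) (f : T -> R) :
  (\sum_(i | A i) f i) ^+ 2 <= #|A|%:R * \sum_(i | A i) f i ^+ 2.
Proof.
set S := \sum_(i | A i) f i; set Q := \sum_(i | A i) f i ^+ 2.
have [A0|A0] := eqVneq #|A| 0%N.
  by rewrite /S big_pred0 ?expr0n ?A0 ?mul0r // => i; move/card0_eq/(_ i): A0.
have k0 : 0 < #|A|%:R :> R by rewrite ltr0n lt0n.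
have : 0 <= \sum_(i | A i) (f i - S / #|A|%:R) ^+ 2 by apply: sumr_ge0 => i _; rewrite sqr_ge0.
under eq_bigr do rewrite sqrrB -mulrnAr.
rewrite big_split sumrB /= -mulr_suml sumr_const -/S -/Q => h.
rewrite mulrC -ler_pdivrMr //; move: h.
rewrite -[_ *+ #|A|]mulr_natr -[_ *+ 2]mulr_natr.
move=> h; rewrite -subr_ge0; apply: le_trans h _; rewrite le_eqVlt; apply/orP; left; apply/eqP.
by field; rewrite lt0r_neq0.
Qed.

Section Chain.
Context {R : realType} {n : nat} {T : finType}.
Variables (w : ('I_n -> int) -> T -> R) (step : ('I_n -> int) -> T -> ('I_n -> int)).

(** Common form of [edge_exp] and [vertex_exp]: the last round is averaged first, so [f] is pulled
    back one transition at a time. *)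
Fixpoint chain_exp (x0 : 'I_n -> int) (t : nat) (f : ('I_n -> int) -> R) : R :=
  if t is t'.+1 then
    chain_exp x0 t' (fun x => \sum_om w x om * f (step x om))
  else f x0.

Hypothesis w_ge0 : forall x om, 0 <= w x om.
Hypothesis w_sum1 : forall x, \sum_om w x om = 1.

Lemma chain_exp_le x0 t f g : (forall x, f x <= g x) ->
  chain_exp x0 t f <= chain_exp x0 t g.
Proof.
elim: t f g => [|t IH] f g fg /=; first exact: fg.
by apply: IH => x; apply: ler_sum => om _; apply: ler_wpM2l.
Qed.

(** Shaped for the union bound: a constant minus a multiple of a finite sum of exponential
    moments. *)
Lemma chain_exp_affine (I : finType) x0 t a b (f : I -> ('I_n -> int) -> R) :
  chain_exp x0 t (fun x => a + b * \sum_i f i x) = a + b * \sum_i chain_exp x0 t (f i).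
Proof.
elim: t f => //= t IH f; rewrite -IH; congr chain_exp; apply/funext => x.
under eq_bigr do rewrite mulrDr mulrCA mulr_sumr.
by rewrite big_split /= -mulr_suml w_sum1 mul1r -mulr_sumr exchange_big.
Qed.

Lemma chain_exp_scale x0 t b f :
  chain_exp x0 t (fun x => b * f x) = b * chain_exp x0 t f.
Proof.
have := chain_exp_affine unit x0 t 0 b (fun=> f).
rewrite !big_const card_unit /= addr0 add0r => <-; congr chain_exp.
by apply/funext => x; rewrite big_const card_unit /= addr0 add0r.
Qed.

End Chain.

Definition loadrv {R : realType} {n : nat} (x : 'I_n -> int) : 'rV[R]_n :=
  \row_u (x u)%:~R.

Definition sqn {R : realType} {n : nat} (z : 'cV[R]_n) : R := \sum_u z u 0 ^+ 2.

Lemma bigmax_le_real {R : realDomainType} {I : finType} (F : I -> R) (c : R) :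
  0 <= c -> (\big[Num.max/0]_i F i <= c) = [forall i, F i <= c].
Proof.
move=> c0; apply/bigmax_leP/forallP => [[_ h] i|h]; first exact: h.
by split=> // i _; apply: h.
Qed.

Section Concentration.
Context {R : realType} {n : nat} {T : finType}.
Variables (w : ('I_n -> int) -> T -> R) (step : ('I_n -> int) -> T -> ('I_n -> int)).
Hypothesis w_ge0 : forall x om, 0 <= w x om.
Hypothesis w_sum1 : forall x, \sum_om w x om = 1.
Variables (P : 'M[R]_n) (V : R).

(* Choosing the budget of one round as the decay of the squared norm of the test
   vector makes the budgets of all rounds telescope. *)
Hypothesis step_mgf : forall x (z : 'cV[R]_n) th,
  \sum_om w x om * expR (th * ((loadrv (step x om) - loadrv x *m P) *m z) 0 0)
    <= expR (th ^+ 2 * V * (sqn z - sqn (P *m z))).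

(** The last round is averaged first and costs [sqn z - sqn (P *m z)]; what remains is the deviation
    of the previous rounds tested against [P *m z], so the costs telescope. *)
Lemma chain_mgf x0 t (z : 'cV[R]_n) th :
  chain_exp w step x0 t (fun x => expR (th * ((loadrv x - xi P x0 t) *m z) 0 0))
    <= expR (th ^+ 2 * V * (sqn z - sqn (iter t (mulmx P) z))).
Proof.
elim: t z => [|t IH] z /=.
  by rewrite /loadrv !subrr mul0mx mxE !mulr0.
apply: (@le_trans _ _ (chain_exp w step x0 t (fun x =>
  expR (th ^+ 2 * V * (sqn z - sqn (P *m z))) *
  expR (th * ((loadrv x - xi P x0 t) *m (P *m z)) 0 0)))).
  apply: chain_exp_le => // x; rewrite mulrC.
  apply: le_trans (ler_wpM2l (expR_ge0 _) (step_mgf x z th)).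
  rewrite mulr_sumr le_eqVlt; apply/orP; left; apply/eqP/eq_bigr => om _.
  rewrite mulrCA -expRD; congr (_ * expR _); rewrite -mulrDr; congr (_ * _).
  (* Inherited deviation, transported by [P], plus the fresh rounding error of this round. *)
  have -> : loadrv (step x om) - xi P x0 t *m P =
      (loadrv x - xi P x0 t) *m P + (loadrv (step x om) - loadrv x *m P).
    by rewrite mulmxBl [RHS]addrC addrA subrK.
  by rewrite mulmxDl mxE mulmxA.
rewrite chain_exp_scale //.
apply: le_trans (ler_wpM2l (expR_ge0 _) (IH (P *m z))) _.
by rewrite -expRD ler_expR -mulrDr -iterSr /= addrA subrK.
Qed.

Lemma sqn_ge0 (z : 'cV[R]_n) : 0 <= sqn z.
Proof. by apply: sumr_ge0 => u _; rewrite sqr_ge0. Qed.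

Lemma sqn_delta (u : 'I_n) : sqn (delta_mx u 0 : 'cV[R]_n) = 1.
Proof.
rewrite /sqn (bigD1 u) //= mxE !eqxx expr1n big1 ?addr0 // => v /negPf vu.
by rewrite mxE vu expr0n.
Qed.

Lemma chain_maxdev x0 t (L : R) : (0 < n)%N -> 0 < V -> 0 <= L ->
  12 * V * ln n%:R <= L ^+ 2 ->
  1 - 2 / n%:R ^+ 2 <=
  chain_exp w step x0 t (fun x => if maxdev x (xi P x0 t) <= L then 1 else 0).
Proof.
move=> n0 V0 L0 hL; have n0' : 0 < n%:R :> R by rewrite ltr0n.
(* Minimizes [- th L + th^2 V]; the minimum [- L^2 / (4 V)] is at most [- 3 ln n]. *)
pose th := L / (2 * V).
(* The boolean chooses the sign of the deviation. The union bound thus has [2 n] terms of size at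
   most [n^-3], which gives [2 / n^2]. *)
pose F (i : 'I_n * bool) x : R :=
  expR ((-1) ^+ i.2 * th * ((loadrv x - xi P x0 t) *m (delta_mx i.1 0 : 'cV_n)) 0 0).
apply: (@le_trans _ _ (chain_exp w step x0 t
  (fun x => 1 + (- expR (- (th * L))) * \sum_i F i x))); last first.
  apply: chain_exp_le => // x; case: ifPn => [_|].
    rewrite gerDl mulNr oppr_le0 mulr_ge0 ?expR_ge0 // sumr_ge0 // => i _.
    exact: expR_ge0.
  (* Off the event, the single term of the violating node [u] with the sign of its deviation already
     exceeds [expR (th L)]. *)
  rewrite bigmax_le_real // => /forallPn[u]; rewrite -ltNge => hu.
  rewrite mulNr subr_le0 -ler_pdivrMl ?expR_gt0 // mulr1 -expRN opprK.
  pose b := (x u)%:~R - xi P x0 t 0 u < 0.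
  rewrite (bigD1 (u, b)) //=; apply: (@le_trans _ _ (F (u, b) x)); last first.
    by rewrite lerDl sumr_ge0 // => i _; exact: expR_ge0.
  rewrite /F /= ler_expR [in leRHS]mulrAC [leRHS]mulrC ler_wpM2l //.
    by rewrite /th divr_ge0 // mulr_ge0 // ltW.
  rewrite -colE !mxE -normrEsign; exact: ltW.
rewrite chain_exp_affine // lerD2l mulNr lerN2.
apply: (@le_trans _ _ (expR (- (th * L)) * \sum_(i : 'I_n * bool) expR (th ^+ 2 * V))).
  rewrite ler_wpM2l ?expR_ge0 //; apply: ler_sum => i _.
  apply: le_trans (chain_mgf _ _ _ _) _; rewrite ler_expR exprMn sqrr_sign mul1r sqn_delta.
  apply: ler_piMr; first by rewrite mulr_ge0 ?sqr_ge0 ?(ltW V0).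
  by rewrite gerBl sqn_ge0.
rewrite sumr_const card_prod card_ord card_bool -[_ *+ (n * 2)]mulr_natr mulrA -expRD natrM.
apply: (@le_trans _ _ ((n%:R ^+ 3)^-1 * (n%:R * 2))); last first.
  rewrite le_eqVlt; apply/orP; left; apply/eqP; field; exact: lt0r_neq0.
rewrite ler_wpM2r ?mulr_ge0 ?ler0n //.
have -> : (n%:R ^+ 3)^-1 = expR (- (3 * ln n%:R)) :> R.
  by rewrite expRN expRM_natl lnK.
rewrite ler_expR /th.
have -> : - (L / (2 * V) * L) + (L / (2 * V)) ^+ 2 * V = - (L ^+ 2 / (4 * V)).
  by field; rewrite lt0r_neq0.
rewrite lerN2 ler_pdivlMr ?mulr_gt0 //; apply: le_trans hL.
by rewrite le_eqVlt; apply/orP; left; apply/eqP; ring.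
Qed.

End Concentration.

(** * Dirichlet energy *)

(** Ordered pairs are summed, so for symmetric [e] each edge counts twice. *)
Definition energy {R : realType} {n : nat} (e : rel 'I_n) (z : 'cV[R]_n) : R :=
  \sum_u \sum_(v | e u v) (z u 0 - z v 0) ^+ 2.

Section DiffusionMatrix.
Context {R : realType} {n : nat}.
Variable e : rel 'I_n.
Hypotheses (esym : symmetric e) (eirr : irreflexive e).

Lemma sum_edge_swap (F : 'I_n -> 'I_n -> R) :
  \sum_u \sum_(v | e u v) F u v = \sum_u \sum_(v | e u v) F v u.
Proof.
rewrite (exchange_big_dep predT) //=; apply: eq_bigr => v _.
by apply: eq_bigl => u; rewrite esym.
Qed.

(** Summation by parts: the energy is twice the quadratic form of the graph Laplacian. *)
Lemma energyE (z : 'cV[R]_n) :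
  energy e z = 2 * \sum_u z u 0 * \sum_(v | e u v) (z u 0 - z v 0).
Proof.
rewrite mulr_sumr /energy; under [RHS]eq_bigr do rewrite mulrA mulr_sumr.
have -> : \sum_u \sum_(v | e u v) 2 * z u 0 * (z u 0 - z v 0) =
    \sum_u \sum_(v | e u v) z u 0 * (z u 0 - z v 0) +
    \sum_u \sum_(v | e u v) z v 0 * (z v 0 - z u 0).
  rewrite [X in _ = _ + X]sum_edge_swap -big_split; apply: eq_bigr => u _ /=.
  by rewrite -big_split; apply: eq_bigr => v _ /=; ring.
rewrite -big_split; apply: eq_bigr => u _ /=.
by rewrite -big_split; apply: eq_bigr => v _ /=; ring.
Qed.

Lemma energy_ge0 (z : 'cV[R]_n) : 0 <= energy e z.
Proof. by apply: sumr_ge0 => u _; apply: sumr_ge0 => v _; rewrite sqr_ge0. Qed.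

Variables gamma Delta : R.

Lemma degE (u : 'I_n) : deg e u = #|e u|.
Proof. by rewrite /deg; apply: eq_card => v; rewrite inE. Qed.

(** That is, [P] is the identity minus the Laplacian over [gamma * Delta]. Irreflexivity matters
    because [Pmat] tests adjacency before the diagonal. *)
Lemma Pmat_mulE (z : 'cV[R]_n) u :
  (Pmat e gamma Delta *m z) u 0 =
  z u 0 - (gamma * Delta)^-1 * \sum_(v | e u v) (z u 0 - z v 0).
Proof.
rewrite mxE sumrB sumr_const -degE mulrBr mulr_sumr opprB addrA addrAC.
rewrite [in RHS]big_mkcond /=.
rewrite -[X in X + _](_ : \sum_v (if u == v then
    (1 - (deg e u)%:R / (gamma * Delta)) * z v 0 else 0) = _); last first.
  rewrite -big_mkcond (big_pred1 u) => [|v]; last by rewrite eq_sym.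
  by rewrite -mulr_natr; ring.
rewrite -big_split; apply: eq_bigr => v _; rewrite !mxE /=.
have [<-|uv] := eqVneq u v; first by rewrite eirr addr0.
by case: (e u v); rewrite ?add0r ?mul0r.
Qed.

Lemma Pmat_tr : (Pmat e gamma Delta)^T = Pmat e gamma Delta.
Proof.
apply/matrixP => u v; rewrite !mxE esym eq_sym.
by have [->|] := eqVneq u v.
Qed.

Hypotheses (gamma1 : 1 < gamma) (Delta0 : 0 < Delta).
Hypothesis deg_le : forall u, (deg e u)%:R <= Delta.

(** With [g = 1 / (gamma Delta)] and [l] the Laplacian of [z], the right side is
    [g * energy - g^2 |l|^2]. Cauchy-Schwarz at each node gives [|l|^2 <= Delta * energy], and
    [gamma > 1] keeps [g - g^2 Delta] positive. *)
Lemma sqn_Pmat_decay (z : 'cV[R]_n) :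
  (gamma - 1) / (gamma ^+ 2 * Delta) * energy e z <=
  sqn z - sqn (Pmat e gamma Delta *m z).
Proof.
pose l u := \sum_(v | e u v) (z u 0 - z v 0).
set g := (gamma * Delta)^-1.
have gamma0 : 0 < gamma := lt_trans ltr01 gamma1.
have g0 : 0 < g by rewrite invr_gt0 mulr_gt0.
have -> : sqn z - sqn (Pmat e gamma Delta *m z) =
    g * energy e z - g ^+ 2 * \sum_u l u ^+ 2.
  rewrite energyE /sqn -sumrB !mulr_sumr -sumrB; apply: eq_bigr => u _.
  by rewrite Pmat_mulE -/g -/(l u); ring.
have h : \sum_u l u ^+ 2 <= Delta * energy e z.
  rewrite /energy mulr_sumr; apply: ler_sum => u _.
  apply: le_trans (sqr_sum_le _ _) _; rewrite -degE ler_wpM2r //.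
  by apply: sumr_ge0 => v _; rewrite sqr_ge0.
have -> : (gamma - 1) / (gamma ^+ 2 * Delta) = g - g ^+ 2 * Delta.
  by rewrite /g; field; rewrite !lt0r_neq0.
rewrite mulrBl lerD2l lerN2 -[leRHS]mulrA.
by apply: ler_wpM2l; rewrite ?sqr_ge0.
Qed.

End DiffusionMatrix.

(** * Edge-based protocol *)

Section ProductWeights.
Context {R : realType} {I J : finType}.
Variable W : I -> J -> R.
Hypothesis W_sum1 : forall i, \sum_j W i j = 1.

Lemma prod_weight_sum1 : \sum_(om : {ffun I -> J}) \prod_i W i (om i) = 1.
Proof. by rewrite -bigA_distr_bigA big1. Qed.

Hypothesis W_ge0 : forall i j, 0 <= W i j.

(** Independence is distributivity: the exponential moment factors over [i], and [mgf_centered]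
    bounds each factor. *)
Lemma prod_weight_mgf (Y : I -> J -> R) (a : I -> R) :
  (forall i, \sum_j W i j * Y i j = 0) ->
  (forall i j, W i j != 0 -> `|Y i j| <= a i) ->
  \sum_(om : {ffun I -> J}) (\prod_i W i (om i)) * expR (\sum_i Y i (om i))
    <= expR (2 * \sum_i a i ^+ 2).
Proof.
move=> Y0 Ya; under eq_bigr do rewrite expR_sum -big_split /=.
rewrite -(bigA_distr_bigA (fun i j => W i j * expR (Y i j))) mulr_sumr expR_sum.
apply: ler_prod => i _; rewrite mgf_centered ?andbT //; last exact: Ya.
by apply: sumr_ge0 => j _; rewrite mulr_ge0 ?expR_ge0.
Qed.

End ProductWeights.

Section EdgeProtocol.
Context {R : realType} {n : nat}.
Variable e : rel 'I_n.
Hypotheses (esym : symmetric e) (eirr : irreflexive e).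

(** [oedge] keeps one orientation of each edge, and irreflexivity removes the diagonal. *)
Lemma sum_oedge (F : 'I_n -> 'I_n -> R) :
  \sum_u \sum_(v | e u v) F u v =
  \sum_(p | oedge e p) (F p.1 p.2 + F p.2 p.1).
Proof.
rewrite big_split /= -!(pair_big_dep predT (fun u v => oedge e (u, v))) /=.
rewrite -(pair_big_dep predT (fun u v => oedge e (u, v)) (fun u v => F v u)) /=.
rewrite [X in _ = _ + X](exchange_big_dep predT) //= -big_split.
apply: eq_bigr => u _; rewrite (bigID (fun v : 'I_n => (u < v)%N)) /=; congr (_ + _).
apply: eq_bigl => v; rewrite /oedge /= esym -leqNgt leq_eqVlt.
by have [/val_inj ->|_] := eqVneq (v : nat) u; rewrite ?eirr.
Qed.

Variable gamma : R.

Lemma qup_ge0_le1 x p : 0 <= qup e gamma x p <= 1.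
Proof.
rewrite /qup; case: ifP; rewrite ?lexx ?ler01 // => _.
by rewrite subr_ge0 floor_le lerBlDl ltW // -[X in _ + X](mulr1z 1) -intrD floorD1_gt.
Qed.

Definition edge_bit_weight (x : 'I_n -> int) (p : 'I_n * 'I_n) (b : bool) : R :=
  if b then qup e gamma x p else 1 - qup e gamma x p.

Lemma edge_bit_weight_ge0 x p b : 0 <= edge_bit_weight x p b.
Proof. by case/andP: (qup_ge0_le1 x p); case: b => /=; rewrite ?subr_ge0. Qed.

Lemma edge_bit_weight_sum1 x p : \sum_b edge_bit_weight x p b = 1.
Proof. by rewrite big_bool /= addrC subrK. Qed.

Lemma eweight_ge0 x om : 0 <= eweight e gamma x om.
Proof. by apply: prodr_ge0 => p _; exact: edge_bit_weight_ge0. Qed.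

Lemma eweight_sum1 x : \sum_om eweight e gamma x om = 1.
Proof. exact: (prod_weight_sum1 _ (edge_bit_weight_sum1 x)). Qed.

Let P := Pmat e gamma (maxdeg e)%:R.

(** Along an edge the ideal and the actual flow share their floor, so their difference is the
    fractional part minus the random bit. It leaves one endpoint and enters the other, hence the
    difference of [z]. *)
Lemma estep_error x om (z : 'cV[R]_n) :
  ((loadrv (estep e gamma x om) - loadrv x *m P) *m z) 0 0 =
  \sum_(p | oedge e p) (qup e gamma x p - (om p)%:R) * (z p.1 0 - z p.2 0).
Proof.
have sumE F : \sum_u (\sum_(v | oedge e (u, v)) F (u, v)) * z u 0 =
    \sum_(p | oedge e p) F p * z p.1 0.
  under eq_bigr do rewrite mulr_suml.
  by rewrite pair_big_dep; apply: eq_big => -[].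
have sumE' F : \sum_u (\sum_(v | oedge e (v, u)) F (v, u)) * z u 0 =
    \sum_(p | oedge e p) F p * z p.2 0.
  under eq_bigr do rewrite mulr_suml.
  by rewrite (exchange_big_dep predT) //= pair_big_dep; apply: eq_big => -[].
have stepE : (loadrv (estep e gamma x om) *m z) 0 0 = \sum_u (x u)%:~R * z u 0 -
    \sum_(p | oedge e p) (eflow e gamma x om p)%:~R * (z p.1 0 - z p.2 0).
  rewrite mxE; under eq_bigr do
    rewrite mxE /estep intrD intrB !rmorph_sum /= mulrDl mulrBl.
  rewrite big_split sumrB /= (sumE (fun p => (eflow e gamma x om p)%:~R)).
  rewrite (sumE' (fun p => (eflow e gamma x om p)%:~R)) -addrA; congr (_ + _).
  by rewrite addrC -sumrB -sumrN; apply: eq_bigr => p _; ring.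
have diffE : (loadrv x *m (P *m z)) 0 0 = \sum_u (x u)%:~R * z u 0 -
    \sum_(p | oedge e p) yval e gamma x p * (z p.1 0 - z p.2 0).
  rewrite mxE; under eq_bigr do rewrite Pmat_mulE // mxE mulrBr mulrCA mulr_sumr.
  rewrite sumrB -mulr_sumr sum_oedge mulr_sumr; congr (_ - _).
  by apply: eq_bigr => p _; rewrite /yval intrB; ring.
rewrite mulmxBl -mulmxA mxE stepE [X in _ + X]mxE diffE opprB addrC addrA subrK -sumrB.
apply: eq_bigr => p hp; rewrite -mulrBl /qup hp /eflow intrD; ring.
Qed.

Hypotheses (gamma1 : 1 < gamma) (maxdeg_gt0 : (0 < maxdeg e)%N).

Lemma estep_mgf x (z : 'cV[R]_n) th :
  \sum_om eweight e gamma x om *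
    expR (th * ((loadrv (estep e gamma x om) - loadrv x *m P) *m z) 0 0) <=
  expR (th ^+ 2 * (gamma ^+ 2 / (gamma - 1) * (maxdeg e)%:R) * (sqn z - sqn (P *m z))).
Proof.
have D0 : 0 < (maxdeg e)%:R :> R by rewrite ltr0n.
(* Pairs outside [oedge] get error 0, so that the weight stays a full product over all pairs. *)
pose Y (p : 'I_n * 'I_n) (b : bool) : R :=
  if oedge e p then th * ((qup e gamma x p - b%:R) * (z p.1 0 - z p.2 0)) else 0.
pose a (p : 'I_n * 'I_n) : R := if oedge e p then `|th * (z p.1 0 - z p.2 0)| else 0.
under eq_bigr do rewrite estep_error mulr_sumr big_mkcond /=.
apply: le_trans (prod_weight_mgf (edge_bit_weight x) (edge_bit_weight_sum1 x)
  (edge_bit_weight_ge0 x) Y a _ _) _.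
- move=> p; rewrite big_bool /Y /edge_bit_weight /=.
  by case: ifP => _; rewrite ?mulr0 ?addr0 //; ring.
- move=> p b _; rewrite /Y /a; case: ifP => _; last by rewrite normr0.
  rewrite mulrCA normrM ler_piMl ?normr_ge0 // ler_norml.
  by case/andP: (qup_ge0_le1 x p) => q0 q1; case: b; apply/andP; split=> /=; lra.
rewrite ler_expR.
(* The factor 2 of the moment bound is exactly the double counting of edges in [energy]. *)
have -> : 2 * \sum_p a p ^+ 2 = th ^+ 2 * energy e z.
  rewrite /energy sum_oedge [in RHS]big_mkcond /= !mulr_sumr; apply: eq_bigr => p _.
  rewrite /a; case: ifP => _; last by rewrite expr0n !mulr0.
  by rewrite real_normK ?num_real //; ring.
rewrite -mulrA ler_wpM2l ?sqr_ge0 //.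
have g0 : 0 < gamma - 1 by rewrite subr_gt0.
have := sqn_Pmat_decay e esym eirr gamma (maxdeg e)%:R gamma1 D0 _ z => /(_ _).
move=> h; rewrite -ler_pdivrMl; last by rewrite mulr_gt0 ?divr_gt0 ?exprn_gt0 // (lt_trans ltr01).
apply: le_trans (h _) => [|u]; last by rewrite ler_nat /maxdeg leq_bigmax.
rewrite le_eqVlt; apply/orP; left; apply/eqP; congr (_ * _); field.
by rewrite !lt0r_neq0 // (lt_trans ltr01).
Qed.

End EdgeProtocol.

(** * Vertex-based protocol *)

(** A uniform [k]-subset of [S] contains [v] with probability [k / #|S|], stated without division.
    The subsets avoiding [v] are the [k]-subsets of [S :\ v]; the others make up the difference of
    two binomials. *)
Lemma card_draws_mem {T : finType} (S : {set T}) (k : nat) (v : T) : v \in S ->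
  (#|S| * #|[set A : {set T} | [&& A \subset S, #|A| == k & v \in A]]| =
   k * 'C(#|S|, k))%N.
Proof.
move=> vS; set X := [set A | _].
have cX : (#|X| + 'C(#|S|.-1, k) = 'C(#|S|, k))%N.
  have -> : #|S|.-1 = #|S :\ v| by rewrite (cardsD1 v S) vS.
  rewrite -!cards_draws -(cardsID [set A : {set T} | v \in A]
    [set A : {set T} | A \subset S & #|A| == k]).
  congr (_ + _)%N; apply: eq_card => A; rewrite !inE.
    by rewrite andbA.
  by rewrite subsetD1 andbCA andbA.
(* For [k > #|S|] both sides vanish; otherwise the truncated subtraction in [mul_bin_down] is
   exact. *)
have [kS|Sk] := leqP k #|S|; last first.
  move: cX; rewrite (bin_small Sk) muln0 => /eqP; rewrite addn_eq0.
  by case/andP=> /eqP-> _; rewrite muln0.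
apply/eqP; rewrite -(eqn_add2r (#|S| * 'C(#|S|.-1, k))) -mulnDr cX mul_bin_down.
by rewrite -mulnDl subnKC.
Qed.

Section VertexProtocol.
Context {R : realType} {n : nat}.
Variables (d : nat) (e : rel 'I_n).
Hypotheses (esym : symmetric e) (eirr : irreflexive e) (ereg : regular e d).

Let D : R := d.+1%:R.

Lemma card_cnbhd u : #|cnbhd e u| = d.+1.
Proof.
rewrite -(ereg u) /cnbhd (_ : [set v | _] = u |: [set v | e u v]).
  by rewrite cardsU1 inE eirr.
by apply/setP => v; rewrite !inE.
Qed.

(** The Euclidean remainder is nonnegative even for negative loads, so [absz] does not alter it. *)
Lemma rem_lt (x : 'I_n -> int) u : (Defs.rem d x u < d.+1)%N.
Proof. by rewrite -ltz_nat gez0_abs ?modz_ge0 // ltz_pmod. Qed.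

Definition draw_weight (x : 'I_n -> int) (u : 'I_n) (A : {set 'I_n}) : R :=
  if (A \subset cnbhd e u) && (#|A| == Defs.rem d x u)
  then ('C(d.+1, Defs.rem d x u))%:R^-1 else 0.

Lemma draw_weight_ge0 x u A : 0 <= draw_weight x u A.
Proof. by rewrite /draw_weight; case: ifP => // _; rewrite invr_ge0. Qed.

Lemma binom_neq0 (x : 'I_n -> int) u : ('C(d.+1, Defs.rem d x u))%:R != 0 :> R.
Proof. by rewrite pnatr_eq0 -lt0n bin_gt0 ltnW // rem_lt. Qed.

Lemma draw_weight_sum1 x u : \sum_A draw_weight x u A = 1.
Proof.
rewrite /draw_weight -big_mkcond sumr_const -[_ *+ _]mulr_natr -cardsE.
by rewrite (cards_draws (cnbhd e u)) card_cnbhd mulVf // binom_neq0.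
Qed.

(** By [card_draws_mem], each of the [d + 1] nodes around [u] gets a surplus token with the same
    probability. *)
Lemma draw_weight_mean x u v : v \in cnbhd e u ->
  \sum_A draw_weight x u A * ((v \in A)%:R - (Defs.rem d x u)%:R / D) = 0.
Proof.
move=> vN; under eq_bigr do rewrite mulrBr; rewrite sumrB -mulr_suml draw_weight_sum1.
rewrite mul1r; apply/eqP; rewrite subr_eq0; apply/eqP.
transitivity (\sum_(A : {set 'I_n} | [&& A \subset cnbhd e u, #|A| == Defs.rem d x u & v \in A])
    ('C(d.+1, Defs.rem d x u))%:R^-1 : R).
  rewrite [RHS]big_mkcond; apply: eq_bigr => A _; rewrite /draw_weight andbA.
  by case: (v \in A); rewrite ?andbT ?andbF ?mulr1 ?mulr0.
rewrite sumr_const -[_ *+ _]mulr_natr -cardsE.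
have /(congr1 (GRing.natmul (1 : R))) := @card_draws_mem _ (cnbhd e u) (Defs.rem d x u) v vN.
rewrite card_cnbhd !natrM -/D => h.
apply: (mulfI (_ : D != 0)); first by rewrite pnatr_eq0.
by rewrite mulrCA h mulrCA mulVf ?binom_neq0 // mulr1 mulrC divfK // pnatr_eq0.
Qed.

Lemma vweight_ge0 x om : 0 <= vweight R e d x om.
Proof. by apply: prodr_ge0 => u _; exact: draw_weight_ge0. Qed.

Lemma vweight_sum1 x : \sum_om vweight R e d x om = 1.
Proof. exact: (prod_weight_sum1 _ (draw_weight_sum1 x)). Qed.

Let gamma : R := 1 + d%:R^-1.
Let P := Pmat e gamma d%:R.

Hypothesis d_gt0 : (0 < d)%N.

Lemma gamma_deg : gamma * d%:R = D.
Proof. by rewrite mulrDl mul1r mulVf ?pnatr_eq0 -?lt0n // natr1. Qed.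

(** Since [gamma d = d + 1], diagonal and edge entries of [P] coincide. *)
Lemma Pmat_cnbhd (z : 'cV[R]_n) u :
  (P *m z) u 0 = D^-1 * \sum_(v in cnbhd e u) z v 0.
Proof.
rewrite Pmat_mulE // gamma_deg sumrB sumr_const -degE ereg -[_ *+ d]mulr_natr.
rewrite [in RHS](bigD1 u) /=; last by rewrite inE eqxx.
rewrite [in RHS](eq_bigl (e u)) => [|v]; last first.
  by rewrite inE; have [->|] := eqVneq v u; rewrite ?andbF ?eirr ?andbT.
by rewrite /D -natr1; field; rewrite natr1 pnatr_eq0.
Qed.

(* Each node hands out exactly its remainder, so its errors sum to 0 and [z u] may be
   subtracted from [z v]. *)
Lemma vstep_error x om (z : 'cV[R]_n) : vweight R e d x om != 0 ->
  ((loadrv (vstep e d x om) - loadrv x *m P) *m z) 0 0 =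
  \sum_u \sum_(v in cnbhd e u)
    ((v \in om u)%:R - (Defs.rem d x u)%:R / D) * (z v 0 - z u 0).
Proof.
move=> /prodf_neq0 supp.
have {supp} supp u : (om u \subset cnbhd e u) && (#|om u| == Defs.rem d x u).
  by have := supp u isT; case: ifP => // _; rewrite eqxx.
have om_sum u (F : 'I_n -> R) : \sum_v (v \in om u)%:R * F v =
    \sum_(v in cnbhd e u) (v \in om u)%:R * F v.
  rewrite [RHS]big_mkcond; apply: eq_bigr => v _; case: ifPn => // vN.
  case: (boolP (v \in om u)) => [vo|_]; last by rewrite mul0r.
  by case/andP: (supp u) => /fintype.subsetP/(_ v vo); rewrite (negPf vN).
(* Tokens are regrouped by sender instead of receiver. *)
have stepE : (loadrv (vstep e d x om) *m z) 0 0 = \sum_u \sum_(v in cnbhd e u)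
    ((x u %/ d.+1%:Z)%Z%:~R + (v \in om u)%:R) * z v 0.
  rewrite mxE; under eq_bigr do rewrite mxE /vstep intrD rmorph_sum /= mulrDl mulr_suml.
  rewrite big_split /= (exchange_big_dep predT) //=.
  have -> : \sum_v #|[set u | v \in om u]|%:Z%:~R * z v 0 = \sum_u \sum_v (v \in om u)%:R * z v 0.
    rewrite exchange_big; apply: eq_bigr => v _; rewrite -mulr_suml; congr (_ * _).
    by rewrite -natr_sum -sum1dep_card big_mkcond.
  rewrite -big_split; apply: eq_bigr => u _ /=; rewrite om_sum -big_split.
  by apply: eq_bigr => v _; rewrite mulrDl.
rewrite mulmxBl -mulmxA mxE stepE [X in _ + X]mxE [X in - X]mxE -sumrB.
apply: eq_bigr => u _; rewrite Pmat_cnbhd mxE mulrA mulr_sumr.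
have card0 : \sum_(v in cnbhd e u) ((v \in om u)%:R - (Defs.rem d x u)%:R / D) = 0.
  rewrite sumrB sumr_const card_cnbhd -[_ *+ _]mulr_natr mulfVK ?pnatr_eq0 //.
  have := om_sum u (fun=> 1); under eq_bigr do rewrite mulr1.
  under [in RHS]eq_bigr do rewrite mulr1.
  move=> <-; case/andP: (supp u) => _ /eqP <-.
  rewrite -sum1_card natr_sum [X in _ - X]big_mkcond -sumrB big1 // => v _.
  by case: (v \in om u); rewrite subrr.
under [RHS]eq_bigr do rewrite mulrBr.
rewrite [RHS]sumrB -[X in _ = _ - X]mulr_suml card0 mul0r subr0 -sumrB; apply: eq_bigr => v _.
rewrite -mulrBl; congr (_ * _).
(* After Euclidean division of [x u], the quotient cancels against the deterministic tokens and only
   the remainder survives. *)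
rewrite {2}(divz_eq (x u) d.+1%:Z) intrD intrM.
have -> : ((x u %% d.+1%:Z)%Z%:~R : R) = (Defs.rem d x u)%:R.
  by rewrite /Defs.rem pmulrn gez0_abs // modz_ge0.
by rewrite mulrDl -/D mulfK ?pnatr_eq0 //; ring.
Qed.

(** The draws of one node are dependent, so all its errors form a single centered variable, bounded
    by the sum of [|th (z u - z v)|] over the neighbors; Cauchy-Schwarz on this sum costs a factor
    [d]. *)
Lemma vstep_mgf x (z : 'cV[R]_n) th :
  \sum_om vweight R e d x om *
    expR (th * ((loadrv (vstep e d x om) - loadrv x *m P) *m z) 0 0) <=
  expR (th ^+ 2 * (2 * d%:R * (d.+1%:R) ^+ 2) * (sqn z - sqn (P *m z))).
Proof.
have d0 : 0 < d%:R :> R by rewrite ltr0n.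
pose Y (u : 'I_n) (A : {set 'I_n}) : R := \sum_(v in cnbhd e u)
    th * (((v \in A)%:R - (Defs.rem d x u)%:R / D) * (z v 0 - z u 0)).
pose a (u : 'I_n) : R := \sum_(v | e u v) `|th * (z u 0 - z v 0)|.
rewrite (eq_bigr (fun om : {ffun 'I_n -> {set 'I_n}} =>
    (\prod_u draw_weight x u (om u)) * expR (\sum_u Y u (om u)))); last first.
  move=> om _; rewrite -/(vweight R e d x om).
  have [->|w0] := eqVneq (vweight R e d x om) 0; first by rewrite !mul0r.
  rewrite vstep_error // mulr_sumr; congr (_ * expR _).
  by apply: eq_bigr => u _; rewrite mulr_sumr.
apply: le_trans (prod_weight_mgf (draw_weight x) (draw_weight_sum1 x)
  (draw_weight_ge0 x) Y a _ _) _.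
- move=> u; rewrite /Y; under eq_bigr do rewrite mulr_sumr.
  rewrite exchange_big big1 //= => v vN.
  rewrite (eq_bigr (fun A : {set 'I_n} => th * (z v 0 - z u 0) *
    (draw_weight x u A * ((v \in A)%:R - (Defs.rem d x u)%:R / D)))) => [|A _]; last by ring.
  by rewrite -mulr_sumr draw_weight_mean ?mulr0.
- move=> u A _; apply: le_trans (ler_norm_sum _ _ _) _.
  rewrite (bigD1 u) /=; last by rewrite inE eqxx.
  rewrite subrr !mulr0 normr0 add0r (eq_bigl (e u)) => [|v]; last first.
    by rewrite inE; have [->|] := eqVneq v u; rewrite ?andbF ?eirr ?andbT.
  apply: ler_sum => v _; rewrite mulrCA normrM distrC [`|th * (z u 0 - _)|]normrM.
  rewrite [`|th * _|]normrM [`|z u 0 - _|]distrC ler_piMl ?mulr_ge0 ?normr_ge0 //.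
  have r0 : 0 <= (Defs.rem d x u)%:R / D by rewrite divr_ge0.
  have r1 : (Defs.rem d x u)%:R / D <= 1.
    by rewrite ler_pdivrMr ?ltr0n // mul1r ler_nat ltnW // rem_lt.
  move: (_ / D) r0 r1 => r r0 r1.
  by rewrite ler_norml; case: (v \in A); apply/andP; split=> /=; lra.
rewrite ler_expR.
apply: (@le_trans _ _ (2 * (d%:R * (th ^+ 2 * energy e z)))).
  rewrite ler_pM2l // /energy !mulr_sumr; apply: ler_sum => u _.
  apply: le_trans (sqr_sum_le _ _) _; rewrite -degE ereg !mulr_sumr.
  apply: ler_sum => v _; rewrite real_normK ?num_real // exprMn; exact: lexx.
have gamma1 : 1 < gamma by rewrite ltrDl invr_gt0.
have deg_le u : (deg e u)%:R <= d%:R :> R by rewrite ereg.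
have h := sqn_Pmat_decay e esym eirr gamma d%:R gamma1 d0 deg_le z.
have -> : th ^+ 2 * (2 * d%:R * d.+1%:R ^+ 2) * (sqn z - sqn (P *m z)) =
  2 * (d%:R * (th ^+ 2 * (d.+1%:R ^+ 2 * (sqn z - sqn (P *m z))))) by ring.
rewrite !ler_wpM2l ?sqr_ge0 ?ler0n // -ler_pdivrMl ?exprn_gt0 ?ltr0n //.
(* For [gamma = 1 + 1/d] the decay constant [(gamma - 1) / (gamma^2 d)] equals [(d + 1)^-2]. *)
apply: le_trans h; rewrite le_eqVlt; apply/orP; left; apply/eqP; congr (_ * _).
rewrite -natr1 /gamma; move: d%:R d0 => r r0.
by field; rewrite !lt0r_neq0 // addr_gt0.
Qed.

End VertexProtocol.

(** * Spectrum and mixing *)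

Lemma char_poly_conj {F : fieldType} {n : nat} (U A : 'M[F]_n) : U \in unitmx ->
  char_poly (invmx U *m A *m U) = char_poly A.
Proof.
move=> Uu; rewrite /char_poly /char_poly_mx !map_mxM /=.
set V := map_mx polyC (invmx U); set W := map_mx polyC U.
have VW : V *m W = 1%:M by rewrite -map_mxM mulVmx // map_mx1.
have -> : 'X%:M - V *m map_mx polyC A *m W = V *m ('X%:M - map_mx polyC A) *m W.
  by rewrite mulmxBr mulmxBl scalar_mxC -[_%:M *m _ *m _]mulmxA VW mulmx1.
by rewrite !det_mulmx mulrAC -det_mulmx VW det1 mul1r.
Qed.

(** Over the complex numbers the symmetric matrix is normal, hence diagonalizable; the identity
    descends by injectivity of the embedding. *)
Lemma trace_expr_spectrum {R : rcfType} {n : nat} (A : 'M[R]_n) (s : seq R) (k : nat) :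
  A^T = A -> char_poly A = \prod_(m <- s) ('X - m%:P) ->
  \tr (A ^+ k) = \sum_(m <- s) m ^+ k.
Proof.
move=> Asym As; pose f := real_complex R; pose Ac := map_mx f A.
have : Ac \is normalmx.
  apply/hermitian_normalmx/realsym_hermsym.
    by apply/is_hermitianmxP/matrixP => i j; rewrite expr0 scale1r !mxE -{1}Asym mxE.
  by apply/mxOverP => i j; rewrite mxE complex_real.
move=> /orthomx_spectralP; set U := spectralmx Ac; set D := spectral_diag Ac => AcE.
have Uu : U \in unitmx := spectral_unit Ac.
(* Unique factorization of the characteristic polynomial identifies the diagonal with [s] as a
   multiset. *)
have sD : perm_eq (map f s) [seq D 0 i | i <- enum 'I_n].
  apply: prod_XsubC_eq; rewrite big_map big_map big_enum /=.
  transitivity (char_poly (diag_mx D)); last first.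
    rewrite char_poly_trig ?diag_mx_is_trig //.
    by apply: eq_bigr => i _; rewrite mxE eqxx.
  rewrite -(char_poly_conj U) // -AcE -map_char_poly As rmorph_prod /=.
  by apply: eq_bigr => m _; rewrite map_polyXsubC.
have AckE : Ac ^+ k = invmx U *m diag_mx (\row_i D 0 i ^+ k) *m U.
  elim: k => [|k IH].
    rewrite expr0 (_ : diag_mx _ = 1%:M); first by rewrite mulmx1 mulVmx.
    by apply/matrixP => i j; rewrite !mxE expr0.
  rewrite exprS IH {1}AcE -[_ * _]/(_ *m _) !mulmxA mulmxK //.
  rewrite -[invmx U *m diag_mx D *m _]mulmxA mulmx_diag.
  by congr (_ *m diag_mx _ *m _); apply/rowP => i; rewrite !mxE exprS.
have mapE : map_mx f (A ^+ k) = Ac ^+ k.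
  elim: {AckE} k => [|k IH]; first by rewrite !expr0 map_mx1.
  by rewrite !exprS -IH -[_ * _]/(_ *m _) -[X in _ = X]/(_ *m _) map_mxM.
apply: (fmorph_inj f); rewrite -trace_map_mx mapE AckE mxtrace_mulC mulmxA mulmxV //.
rewrite mul1mx mxtrace_diag; under eq_bigr do rewrite mxE.
transitivity (\sum_(x <- map f s) x ^+ k).
  by rewrite (perm_big _ sD) big_map big_enum.
by rewrite big_map rmorph_sum; apply: eq_bigr => m _; rewrite rmorphXn.
Qed.

(** * Convergence of the continuous process to the uniform load *)

Section Mixing.
Context {R : realType} {n : nat}.
Variables (e : rel 'I_n) (P : 'M[R]_n) (c : R).
Hypotheses (conn : graph_connected e) (n_gt0 : (0 < n)%N).

Lemma path_energy (z : 'cV[R]_n) u p : path e u p ->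
  `|z u 0 - z (last u p) 0| <= (size p)%:R * Num.sqrt (energy e z).
Proof.
elim: p u => [|v p IH] u /=; first by rewrite subrr normr0 mul0r.
case/andP => uv /IH h; rewrite -natr1 mulrDl mul1r [leRHS]addrC.
have -> : z u 0 - z (last v p) 0 = (z u 0 - z v 0) + (z v 0 - z (last v p) 0) by ring.
apply: le_trans (ler_normD _ _) _; apply: lerD => //.
rewrite -sqrtr_sqr ler_wsqrtr // /energy (bigD1 u) //= (bigD1 v) //= -addrA.
rewrite lerDl addr_ge0 //; first by apply: sumr_ge0 => w _; rewrite sqr_ge0.
by apply: sumr_ge0 => w _; apply: sumr_ge0 => w' _; rewrite sqr_ge0.
Qed.

(** Two nodes are joined by a simple path of at most [n] edges, so [path_energy] bounds each
    [(z u - z v)^2] by [n^2] times the energy; for mean zero these squares sum to [2 n * sqn z]. The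
    constant is crude, but only its finiteness affects the mixing bound. *)
Lemma poincare (z : 'cV[R]_n) : \sum_u z u 0 = 0 ->
  sqn z <= n%:R ^+ 3 * energy e z.
Proof.
move=> z0; have E0 := energy_ge0 e z; have n0 : 0 < n%:R :> R by rewrite ltr0n.
have h u v : (z u 0 - z v 0) ^+ 2 <= n%:R ^+ 2 * energy e z.
  have /connectP[p /shortenP[q pq uq _] ->] := conn u v.
  have sq : (size q <= n)%N.
    by have := max_card (mem (u :: q)); rewrite (card_uniqP uq) card_ord => /ltnW.
  rewrite -(real_normK (num_real _)) -(sqr_sqrtr E0) -exprMn.
  rewrite lerXn2r ?nnegrE ?mulr_ge0 ?sqrtr_ge0 //; apply: le_trans (path_energy z u q pq) _.
  by rewrite ler_wpM2r ?sqrtr_ge0 // ler_nat.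
have sumE : \sum_u \sum_v (z u 0 - z v 0) ^+ 2 = 2 * (n%:R * sqn z).
  rewrite (eq_bigr (fun u => n%:R * z u 0 ^+ 2 + sqn z)) => [|u _]; last first.
    rewrite (eq_bigr (fun v => z u 0 ^+ 2 - 2 * z u 0 * z v 0 + z v 0 ^+ 2)) => [|v _];
      last by ring.
    rewrite big_split sumrB /= -[X in _ - X]mulr_sumr z0 mulr0 subr0 sumr_const card_ord.
    by rewrite -[_ *+ n]mulr_natl.
  rewrite big_split /= -[X in X + _]mulr_sumr sumr_const card_ord -[_ *+ n]mulr_natl.
  by rewrite -/(sqn z); ring.
have : \sum_u \sum_v (z u 0 - z v 0) ^+ 2 <= \sum_(u : 'I_n) \sum_(v : 'I_n) n%:R ^+ 2 * energy e z.
  by apply: ler_sum => u _; apply: ler_sum => v _; exact: h.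
rewrite sumE !sumr_const !card_ord -!mulrnA -[_ *+ (n * n)]mulr_natl natrM => h2.
rewrite -(ler_pM2l n0); have s0 := sqn_ge0 z; have := mulr_ge0 (ltW n0) s0.
move: h2; set a := n%:R * sqn z; set b := energy e z in E0 *.
have -> : n%:R * n%:R * (n%:R ^+ 2 * b) = n%:R * (n%:R ^+ 3 * b) by ring.
lra.
Qed.

Hypotheses (c_gt0 : 0 < c) (Psym : P^T = P).
Hypothesis Pconst : P *m const_mx 1 = const_mx 1 :> 'cV[R]_n.
Hypothesis Pdecay : forall z : 'cV[R]_n, c * energy e z <= sqn z - sqn (P *m z).

(** Squared Frobenius distance from [P ^+ t] to the uniform averaging matrix. *)
Let phi (t : nat) : R := \sum_u \sum_v ((P ^+ t) u v - n%:R^-1) ^+ 2.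

Lemma trmxX t : (P ^+ t)^T = P ^+ t.
Proof.
elim: t => [|t IH]; first by rewrite expr0 trmx1.
by rewrite exprS -[_ * _]/(_ *m _) trmx_mul IH Psym -[LHS]/(_ * _) -exprSr exprS.
Qed.

Lemma expr_const t : P ^+ t *m const_mx 1 = const_mx 1 :> 'cV[R]_n.
Proof.
elim: t => [|t IH]; first by rewrite expr0 mul1mx.
by rewrite exprSr -[_ * _]/(_ *m _) -mulmxA Pconst.
Qed.

Lemma row_sum1 t u : \sum_v (P ^+ t) u v = 1.
Proof.
have /matrixP/(_ u 0) := expr_const t; rewrite !mxE => <-.
by apply: eq_bigr => v _; rewrite mxE mulr1.
Qed.

Lemma expr_sym t u v : (P ^+ t) u v = (P ^+ t) v u.
Proof. by rewrite -{1}trmxX mxE. Qed.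

Lemma phi_trace t : phi t = \tr (P ^+ (t + t)) - 1.
Proof.
have nn0 : n%:R != 0 :> R by rewrite pnatr_eq0 -lt0n.
rewrite /mxtrace [X in _ - X](_ : 1 = \sum_(u : 'I_n) n%:R^-1); last first.
  by rewrite sumr_const card_ord -[_ *+ n]mulr_natl divff.
rewrite -sumrB.
apply: eq_bigr => u _.
rewrite (eq_bigr (fun v => (P ^+ t) u v * (P ^+ t) v u - 2 * n%:R^-1 * (P ^+ t) u v +
  n%:R^-1 ^+ 2)); last first.
  by move=> v _; rewrite (expr_sym t v u); ring.
rewrite big_split sumrB /= -mulr_sumr row_sum1 sumr_const card_ord exprD -[_ *+ n]mulr_natl.
by rewrite [X in _ = X - _]mxE; field.
Qed.

(** Each column of [P ^+ t] minus the uniform vector has mean zero and is advanced by [P], so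
    [Pdecay] and [poincare] apply column by column. *)
Lemma phi_decay t : c / n%:R ^+ 3 * phi t <= phi t - phi t.+1.
Proof.
have n0 : 0 < n%:R ^+ 3 :> R by rewrite exprn_gt0 // ltr0n.
pose z t (w : 'I_n) : 'cV[R]_n := col w (P ^+ t) - n%:R^-1 *: const_mx 1.
have phiE t' : phi t' = \sum_w sqn (z t' w).
  rewrite /phi exchange_big; apply: eq_bigr => w _; apply: eq_bigr => u _.
  by rewrite !mxE mulr1.
rewrite !phiE -sumrB mulr_sumr; apply: ler_sum => w _.
have -> : z t.+1 w = P *m z t w.
  by rewrite /z mulmxBr -scalemxAr Pconst !colE mulmxA exprS.
apply: le_trans (Pdecay _); rewrite -mulrA ler_pM2l // ler_pdivrMl //; apply: poincare.
rewrite (eq_bigr (fun u => (P ^+ t) w u - n%:R^-1)) => [|u _]; last by rewrite !mxE expr_sym mulr1.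
by rewrite sumrB row_sum1 sumr_const card_ord -[_ *+ n]mulr_natl divff ?subrr // pnatr_eq0 -lt0n.
Qed.

Variable s : seq R.
Hypotheses (n_gt1 : (1 < n)%N) (spec : sorted_spectrum P s).

Lemma one_in_spectrum : 1 \in s.
Proof.
have : eigenvalue P 1.
  apply/eigenvalueP; exists (const_mx 1 : 'rV_n).
    by rewrite scale1r -[LHS]trmxK trmx_mul Psym trmx_const Pconst trmx_const.
  by apply/eqP => /rowP/(_ (Ordinal n_gt0))/eqP; rewrite !mxE oner_eq0.
by rewrite eigenvalue_root_char spec.2 root_prod_XsubC.
Qed.

Lemma phi_spectrum t : phi t = \sum_(m <- rem 1 s) m ^+ (t + t).
Proof.
rewrite phi_trace (trace_expr_spectrum _ s) ?spec.2 //.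
by rewrite (perm_big _ (perm_to_rem one_in_spectrum)) big_cons expr1n addrAC subrr add0r.
Qed.

Lemma sqr_expr_ge0 (m : R) t : 0 <= m ^+ (t + t).
Proof. by rewrite exprD -expr2 sqr_ge0. Qed.

(** An eigenvalue with [|m| >= 1] would keep [phi t >= 1] forever, and then [phi_decay] would lower
    [phi] by a fixed positive amount each round. This excludes both a second eigenvalue 1 and the
    eigenvalue -1. *)
Lemma rem_spectrum_lt1 m : m \in rem 1 s -> `|m| < 1.
Proof.
move=> ms; rewrite ltNge; apply/negP => m1.
have phi_ge1 t : 1 <= phi t.
  rewrite phi_spectrum (big_rem m) //=; apply: (@le_trans _ _ (m ^+ (t + t))).
    by rewrite -(ger0_norm (sqr_expr_ge0 m t)) normrX exprn_ege1.
  by rewrite lerDl sumr_ge0 // => ? _; exact: sqr_expr_ge0.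
have c0 : 0 < c / n%:R ^+ 3 by rewrite divr_gt0 // exprn_gt0 // ltr0n.
have lin t : phi t <= phi 0 - t%:R * (c / n%:R ^+ 3).
  elim: t => [|t IH]; first by rewrite mul0r subr0.
  have h := phi_decay t; rewrite -natr1.
  have h1 : c / n%:R ^+ 3 <= c / n%:R ^+ 3 * phi t by rewrite ler_peMr // ltW.
  by move: (c / _) c0 IH h h1 => k k0 IH h h1; lra.
have phi0 : 0 <= phi 0 / (c / n%:R ^+ 3) by rewrite divr_ge0 ?(ltW c0) // (le_trans ler01).
have := archi_boundP phi0; set N := Num.bound _; rewrite ltr_pdivrMr // => hN.
by have := lin N; have := phi_ge1 N; lra.
Qed.

Lemma lam_of_spectrum :
  lam_of s < 1 /\ forall m, m \in rem 1 s -> `|m| <= lam_of s.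
Proof.
have lt1 := rem_spectrum_lt1; have in1 := one_in_spectrum; have srt := spec.1.
have ge_trans : transitive (fun a b : R => b <= a) by move=> a b d ab bd; exact: le_trans bd ab.
have : size s = n.
  have /(congr1 (fun p : {poly R} => size p)) := spec.2.
  rewrite size_char_poly size_prod_XsubC => -[] //.
move: lt1 in1 srt; case: s => [|x s'] //= lt1 in1 srt.
have /allP s'x := order_path_min ge_trans srt.
(* Otherwise the head would survive in [rem 1 s] and be below 1, although it dominates the entry 1
   of the sorted list. *)
have x1 : x = 1.
  have [//|x1] := eqVneq x 1.
  have : x \in (if x == 1 then s' else x :: rem 1 s') by rewrite (negPf x1) mem_head.
  move/lt1; rewrite ltNge => /negP[].
  apply: le_trans (ler_norm _); move: in1; rewrite inE => /predU1P[->//|]; exact: s'x.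
move: lt1 srt {in1 s'x}; rewrite x1 eqxx => lt1 /path_sorted.
case: s' lt1 => [_ _ n1|y s' lt1 /= srt _]; first by move: n_gt1; rewrite -n1.
rewrite /lam_of /= gt_max !lt1 ?mem_head ?mem_last //; split=> // m ms.
(* A nonnegative eigenvalue is at most the second entry; a negative one is at least the last. *)
rewrite le_max; have [m0|m0] := leP 0 m.
  apply/orP; left; rewrite (ger0_norm m0); apply: le_trans (ler_norm _).
  move: ms; rewrite inE => /predU1P[->//|]; exact: (allP (order_path_min ge_trans srt)).
apply/orP; right; rewrite (ltr0_norm m0) -normrN; apply: le_trans (ler_norm _).
rewrite lerN2; move: ms; rewrite inE => /predU1P[->|].
  have := mem_last y s'; rewrite inE => /predU1P[->//|].
  exact: (allP (order_path_min ge_trans srt)).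
move=> ms; case/splitPr: ms srt => p1 p2; rewrite cat_path last_cat /= => /and3P[_ _ srt].
have := mem_last m p2; rewrite inE => /predU1P[->//|].
exact: (allP (order_path_min ge_trans srt)).
Qed.

Lemma lam_of_ge0 : 0 <= lam_of s.
Proof. by rewrite /lam_of le_max normr_ge0. Qed.

(** The square of one entry is at most [phi t], a sum of at most [n] terms bounded by
    [lam_of s ^+ (2 t)]; relaxing [n] to [n^2] avoids a square root. *)
Lemma expr_dev t u v : `|(P ^+ t) u v - n%:R^-1| <= n%:R * lam_of s ^+ t.
Proof.
have [_ lamP] := lam_of_spectrum; have lam0 := lam_of_ge0.
rewrite -(@ler_pXn2r _ 2) ?nnegrE ?mulr_ge0 ?exprn_ge0 // real_normK ?num_real //.
apply: (@le_trans _ _ (phi t)).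
  rewrite /phi (bigD1 u) //= (bigD1 v) //= -addrA lerDl addr_ge0 //.
    by apply: sumr_ge0 => w _; rewrite sqr_ge0.
  by apply: sumr_ge0 => w _; apply: sumr_ge0 => w' _; rewrite sqr_ge0.
rewrite phi_spectrum; apply: (@le_trans _ _ (\sum_(m <- rem 1 s) lam_of s ^+ (t + t))).
  rewrite big_seq [leRHS]big_seq; apply: ler_sum => m ms.
  rewrite -(ger0_norm (sqr_expr_ge0 m t)) normrX.
  by rewrite lerXn2r ?nnegrE ?lamP.
have ss : (size (rem 1%R s) <= n)%N.
  have /(congr1 (fun p : {poly R} => size p)) := spec.2.
  rewrite size_char_poly size_prod_XsubC => -[->].
  by rewrite size_rem ?one_in_spectrum // leq_pred.
rewrite big_const_seq count_predT iter_addr addr0 -[_ *+ _]mulr_natl exprMn -exprM muln2 -addnn.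
rewrite ler_wpM2r ?exprn_ge0 // -natrX ler_nat (leq_trans ss) //.
by rewrite expnS expn1 leq_pmulr.
Qed.

Lemma xi_expr x0 t : xi P x0 t = loadrv x0 *m P ^+ t.
Proof. by elim: t => [|t IH] /=; rewrite ?expr0 ?mulmx1 // IH exprSr -mulmxA. Qed.

(** The deviation from the mean load is at most [n K * n lam^t], and the factor 2 in the time makes
    [lam^t <= (K n)^-2], leaving [1 / K <= 1]. *)
Lemma xi_flat x0 t : 1 <= disc x0 ->
  2 * ln ((disc x0)%:~R * n%:R) / (1 - lam_of s) <= t%:R ->
  exists mu, forall v, `|xi P x0 t 0 v - mu| <= 1.
Proof.
move=> K1 ht; have [lam1 _] := lam_of_spectrum; have lam0 := lam_of_ge0.
pose K : R := (disc x0)%:~R; have K1' : 1 <= K by rewrite -[1]/(1%:~R) ler_int.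
have n1 : 1 <= n%:R :> R by rewrite ler1n.
have Kn0 : 0 < K * n%:R by rewrite mulr_gt0 // (lt_le_trans ltr01).
(* Loads relative to a reference node are bounded by the discrepancy; unit column sums make the
   shift harmless. *)
pose a := Ordinal n_gt0; pose y w : R := (x0 w - x0 a)%:~R.
have yK w : `|y w| <= K.
  rewrite /y -intr_norm ler_int /disc; apply: le_trans (le_bigmax _ _ w).
  exact: (le_bigmax _ (fun v => `|x0 w - x0 v|) a).
exists ((x0 a)%:~R + \sum_w y w / n%:R) => v.
have -> : xi P x0 t 0 v - ((x0 a)%:~R + \sum_w y w / n%:R) =
    \sum_w y w * ((P ^+ t) w v - n%:R^-1).
  rewrite xi_expr mxE opprD addrA; under [RHS]eq_bigr do rewrite mulrBr.
  rewrite sumrB; congr (_ - _).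
  have cs : \sum_w (P ^+ t) w v = 1.
    by under eq_bigr do rewrite expr_sym; rewrite row_sum1.
  rewrite [X in _ - X](_ : _ = \sum_w (x0 a)%:~R * (P ^+ t) w v); last first.
    by rewrite -mulr_sumr cs mulr1.
  rewrite -sumrB; apply: eq_bigr => w _.
  by rewrite mxE /y intrB mulrBl.
apply: le_trans (ler_norm_sum _ _ _) _.
apply: (@le_trans _ _ (\sum_(w : 'I_n) K * (n%:R * lam_of s ^+ t))).
  by apply: ler_sum => w _; rewrite normrM ler_pM ?normr_ge0 ?expr_dev.
rewrite sumr_const card_ord -[_ *+ n]mulr_natl.
have lam_exp : lam_of s ^+ t <= expR (- (t%:R * (1 - lam_of s))).
  rewrite -mulrN expRM_natl lerXn2r ?nnegrE ?expR_ge0 //.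
  by have := expR_ge1Dx (- (1 - lam_of s)); lra.
have {}lam_exp : lam_of s ^+ t <= (K * n%:R) ^- 2.
  apply: le_trans lam_exp _; rewrite expRN -[K * n%:R]lnK // -expRM_natl.
  rewrite lef_pV2 ?posrE ?expR_gt0 //.
  by rewrite ler_expR -ler_pdivrMr // subr_gt0.
have K0 : 0 < K by exact: lt_le_trans K1'.
have n0 : 0 < n%:R :> R by rewrite ltr0n.
apply: (@le_trans _ _ (n%:R * (K * (n%:R * (K * n%:R) ^- 2)))).
  by rewrite !ler_pM2l.
have -> : n%:R * (K * (n%:R * (K * n%:R) ^- 2)) = K^-1.
  by field; rewrite !lt0r_neq0.
by rewrite invf_le1.
Qed.

End Mixing.

(** * Deviation and discrepancy *)

Lemma connected_deg_gt0 {n : nat} (e : rel 'I_n) (u : 'I_n) :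
  (1 < n)%N -> graph_connected e -> (0 < deg e u)%N.
Proof.
move=> n1 conn; have [v uv] : exists v : 'I_n, v != u.
  case: (eqVneq u (Ordinal (ltnW n1))) => [->|]; last by exists (Ordinal (ltnW n1)); rewrite eq_sym.
  by exists (Ordinal n1).
case/connectP: (conn u v) uv => -[|w p] /= => [_ ->|/andP[uw _] _ _]; first by rewrite eqxx.
by rewrite /deg card_gt0; apply/set0Pn; exists w; rewrite inE.
Qed.

Lemma disc_le_maxdev {R : realType} {n : nat} (x : 'I_n -> int) (y : 'rV[R]_n) (mu L : R) :
  0 <= L -> maxdev x y <= L -> (forall v, `|y 0 v - mu| <= 1) ->
  (disc x)%:~R <= 2 * L + 2.
Proof.
move=> L0; rewrite bigmax_le_real // => /forallP xy ymu.
(* [disc] is a maximum of integers while the bound is real, so the bound is carried as a predicate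
   closed under [Num.max]. *)
pose Q (k : int) := k%:~R <= 2 * L + 2.
have Qmax a b : Q a -> Q b -> Q (Num.max a b) by rewrite maxEle; case: ifP.
have Q0 : Q 0 by rewrite /Q; lra.
apply: (big_ind Q) => // u _; apply: (big_ind Q) => // v _; rewrite /Q intr_norm intrB.
have -> : (x u)%:~R - (x v)%:~R = ((x u)%:~R - y 0 u) + (y 0 u - mu)
    + ((mu - y 0 v) + (y 0 v - (x v)%:~R)) by ring.
apply: le_trans (ler_normD _ _) _; apply: (@le_trans _ _ ((L + 1) + (1 + L))); last by lra.
apply: lerD; apply: le_trans (ler_normD _ _) _; apply: lerD => //.
  by rewrite distrC.
by rewrite distrC.
Qed.

(** Absorbs the additive 2 of [disc_le_maxdev] into the main term, through [ln 2 >= 1/2 >= 4/9]. *)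
Lemma sqrt_ln_ge {R : realType} (n : nat) (D : R) : (1 < n)%N -> 1 <= D ->
  2 <= 3 * Num.sqrt (D * ln n%:R).
Proof.
move=> n1 D1; have ln2 : 1 / 2 <= ln 2 :> R.
  rewrite -ler_expR lnK ?posrE // -[leRHS]invrK -[leLHS]invrK -expRN.
  rewrite lef_pV2 ?posrE ?expR_gt0 ?invr_gt0 //.
  by have := expR_ge1Dx (- (1 / 2) : R); lra.
have : 1 / 2 <= D * ln n%:R.
  have : ln 2 <= ln n%:R :> R by rewrite ler_ln ?posrE ?ltr0n ?ler_nat // ltnW.
  nra.
move=> h; have : Num.sqrt (4 / 9) <= Num.sqrt (D * ln n%:R) by rewrite ler_wsqrtr //; lra.
have -> : 4 / 9 = (2 / 3) ^+ 2 :> R by field.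
by rewrite sqrtr_sqr ger0_norm //; lra.
Qed.

(** * Both conclusions for an abstract chain *)

Section ChainBounds.
Context {R : realType} {n : nat} {T : finType}.
Variables (w : ('I_n -> int) -> T -> R) (step : ('I_n -> int) -> T -> ('I_n -> int)).
Hypothesis w_ge0 : forall x om, 0 <= w x om.
Hypothesis w_sum1 : forall x, \sum_om w x om = 1.

Lemma chain_prob_ge0 x0 t (A : pred ('I_n -> int)) :
  0 <= chain_exp w step x0 t (fun x => if A x then 1 else 0).
Proof.
rewrite -[X in X <= _](mul0r (chain_exp w step x0 t (fun=> 0))) -chain_exp_scale //.
by apply: chain_exp_le => // x; rewrite mul0r; case: ifP.
Qed.

(** For [n = 1] the probability bound is negative and the discrepancy is 0. *)
Lemma chain_bounds_le1 (A : nat -> pred ('I_n -> int)) x0 : (0 < n)%N -> (n <= 1)%N ->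
  (forall t, 1 - 2 / n%:R <= chain_exp w step x0 t (fun x => if A t x then 1 else 0)) /\
  ~ (1 <= disc x0)%R.
Proof.
move=> n0 n1; have {n0 n1} n1 : n = 1%N by apply/eqP; rewrite eqn_leq n1.
split=> [t|].
  by apply: le_trans (chain_prob_ge0 _ _ _); rewrite n1 divr1; lra.
apply/negP; rewrite -ltNge; apply: (@le_lt_trans _ _ 0) => //.
apply: bigmax_le => // u _; apply: bigmax_le => // v _.
suff -> : u = v by rewrite subrr normr0.
by move: (u) (v); rewrite n1 => a b; rewrite !ord1.
Qed.

Variables (e : rel 'I_n) (P : 'M[R]_n) (V c L L2 : R).
Hypotheses (n_gt1 : (1 < n)%N) (conn : graph_connected e).
Hypotheses (Psym : P^T = P) (Pconst : P *m const_mx 1 = const_mx 1 :> 'cV[R]_n).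
Hypotheses (c_gt0 : 0 < c) (Pdecay : forall z : 'cV[R]_n, c * energy e z <= sqn z - sqn (P *m z)).
Hypothesis step_mgf : forall x (z : 'cV[R]_n) th,
  \sum_om w x om * expR (th * ((loadrv (step x om) - loadrv x *m P) *m z) 0 0)
    <= expR (th ^+ 2 * V * (sqn z - sqn (P *m z))).
Hypotheses (V_gt0 : 0 < V) (L_ge0 : 0 <= L) (VL : 12 * V * ln n%:R <= L ^+ 2).
Hypothesis LL2 : 2 * L + 2 <= L2.

(** For [n >= 2] the failure probability [2 / n^2] is at most [1 / n], so a single deviation event
    serves both conclusions. *)
Lemma chain_bounds x0 :
  (forall t, 1 - 2 / n%:R <=
    chain_exp w step x0 t (fun x => if maxdev x (xi P x0 t) <= L then 1 else 0)) /\
  ((1 <= disc x0)%R -> forall s, sorted_spectrum P s ->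
    forall t : nat, 2 * ln ((disc x0)%:~R * n%:R) / (1 - lam_of s) <= t%:R ->
    1 - 1 / n%:R <= chain_exp w step x0 t (fun x => if (disc x)%:~R <= L2 then 1 else 0)).
Proof.
have n_gt0 := ltnW n_gt1.
have n2 : 2 <= n%:R :> R by rewrite ler_nat.
have n0 : 0 < n%:R :> R by rewrite ltr0n.
have bound t : 1 - 1 / n%:R <=
    chain_exp w step x0 t (fun x => if maxdev x (xi P x0 t) <= L then 1 else 0).
  apply: le_trans (chain_maxdev w step w_ge0 w_sum1 P V step_mgf x0 t L n_gt0 V_gt0 L_ge0 VL).
  have -> : 1 / n%:R = n%:R / n%:R ^+ 2 :> R by field; rewrite lt0r_neq0.
  by rewrite lerD2l lerN2 ler_pM2r ?invr_gt0 ?exprn_gt0.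
split=> [t|K1 s spec t ht].
  apply: le_trans (bound t); rewrite lerD2l lerN2 ler_pM2r ?invr_gt0 //; lra.
have [mu xi_mu] := xi_flat e P c conn n_gt0 c_gt0 Psym Pconst Pdecay s n_gt1 spec x0 t K1 ht.
apply: le_trans (bound t) _; apply: chain_exp_le => // x.
case: ifPn => [hL|_]; last by case: ifP.
by rewrite (le_trans (disc_le_maxdev x _ mu L L_ge0 hL xi_mu) LL2).
Qed.

End ChainBounds.

Lemma edge_exp_chain {R : realType} {n : nat} (e : rel 'I_n) (gamma : R) x0 t f :
  edge_exp e gamma x0 t f = chain_exp (eweight e gamma) (estep e gamma) x0 t f.
Proof. by elim: t f => //= t IH f; rewrite IH. Qed.

Lemma vertex_exp_chain {R : realType} {n : nat} (e : rel 'I_n) d x0 t (f : _ -> R) :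
  vertex_exp e d x0 t f = chain_exp (vweight R e d) (vstep e d) x0 t f.
Proof. by elim: t f => //= t IH f; rewrite IH. Qed.

Lemma Pmat_const {R : realType} {n : nat} (e : rel 'I_n) (gamma Delta : R) :
  irreflexive e -> Pmat e gamma Delta *m const_mx 1 = const_mx 1 :> 'cV[R]_n.
Proof.
move=> eirr; apply/colP => u; rewrite Pmat_mulE // big1 => [|v _]; rewrite !mxE ?subrr //.
by rewrite mulr0 subr0.
Qed.

Theorem theorem5p5 (R : realType) :
  (* (a) edge-based protocol, gamma > 1 any constant *)
  (forall gamma : R, 1 < gamma ->
    exists C C1 C2 : R, [/\ 0 < C, 0 < C1, 0 < C2 &
    forall (n : nat) (e : rel 'I_n), (0 < n)%N -> symmetric e -> irreflexive e ->
    graph_connected e ->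
    forall x0 : 'I_n -> int,
      let Delta : R := (maxdeg e)%:R in
      let P := Pmat e gamma Delta in
      (forall t : nat,
         edge_prob e gamma x0 t
           (fun x => maxdev x (xi P x0 t) <= C * Num.sqrt (Delta * ln n%:R))
         >= 1 - 2 / n%:R)
      /\
      ((1 <= disc x0)%R -> forall s : seq R, sorted_spectrum P s ->
       forall t : nat, C1 * ln ((disc x0)%:~R * n%:R) / (1 - lam_of s) <= t%:R ->
         edge_prob e gamma x0 t
           (fun x => (disc x)%:~R <= C2 * Num.sqrt (Delta * ln n%:R))
         >= 1 - 1 / n%:R)])
  /\
  (* (b) vertex-based protocol on d-regular graphs, gamma = 1 + 1/d *)
  (exists C C1 C2 : R, [/\ 0 < C, 0 < C1, 0 < C2 &
    forall (n d : nat) (e : rel 'I_n), (0 < n)%N -> symmetric e -> irreflexive e ->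
    graph_connected e -> regular e d ->
    forall x0 : 'I_n -> int,
      let P := Pmat e (1 + d%:R^-1) d%:R in
      (forall t : nat,
         @vertex_prob R n e d x0 t
           (fun x => maxdev x (xi P x0 t) <= C * d%:R ^+ 2 * Num.sqrt (ln n%:R))
         >= 1 - 2 / n%:R)
      /\
      ((1 <= disc x0)%R -> forall s : seq R, sorted_spectrum P s ->
       forall t : nat, C1 * ln ((disc x0)%:~R * n%:R) / (1 - lam_of s) <= t%:R ->
         @vertex_prob R n e d x0 t
           (fun x => (disc x)%:~R <= C2 * d%:R ^+ 2 * Num.sqrt (ln n%:R))
         >= 1 - 1 / n%:R)]).

Proof.
split=> [gamma gamma1|].
  have g0 : 0 < gamma by exact: lt_trans gamma1.
  pose k := gamma ^+ 2 / (gamma - 1).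
  have k0 : 0 < k by rewrite divr_gt0 ?exprn_gt0 ?subr_gt0.
  (* Chosen so that [(C L)^2] equals [12 V ln n] with [V = k Delta]. *)
  pose C := Num.sqrt (12 * k); have C0 : 0 < C by rewrite sqrtr_gt0 mulr_gt0.
  exists C, 2, (2 * C + 3); split=> //; first by lra.
  move=> n e n0 esym eirr conn x0 Delta P.
  have w0 := @eweight_ge0 R n e gamma; have w1 := @eweight_sum1 R n e gamma.
  have [n1|n1] := leqP n 1.
    have [h1 h2] := chain_bounds_le1 _ (estep e gamma) w0 w1
      (fun t x => maxdev x (xi P x0 t) <= C * Num.sqrt (Delta * ln n%:R)) x0 n0 n1.
    by split=> [t|/h2//]; rewrite /edge_prob edge_exp_chain; exact: h1.
  have deg_le u : (deg e u)%:R <= Delta by rewrite ler_nat /maxdeg leq_bigmax.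
  have D1 : 1 <= Delta.
    by apply: le_trans (deg_le (Ordinal n0)); rewrite ler1n connected_deg_gt0.
  have D0 : 0 < Delta by exact: lt_le_trans D1.
  have ln0 : 0 <= ln n%:R :> R by rewrite ln_ge0 // ler1n.
  have c0 : 0 < (gamma - 1) / (gamma ^+ 2 * Delta).
    by rewrite divr_gt0 ?subr_gt0 // mulr_gt0 // exprn_gt0.
  have m0 : (0 < maxdeg e)%N by rewrite -(ltr0n R).
  have q := sqrt_ln_ge n Delta n1 D1; set L := Num.sqrt (Delta * ln n%:R) in q *.
  have L0 : 0 <= L := sqrtr_ge0 _.
  have V0 : 0 < k * Delta by rewrite mulr_gt0.
  have VL : 12 * (k * Delta) * ln n%:R <= (C * L) ^+ 2.
    have Dl : 0 <= Delta * ln n%:R by rewrite mulr_ge0 // ltW.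
    have kk : 0 <= 12 * k by rewrite mulr_ge0 // ltW.
    by rewrite exprMn (sqr_sqrtr Dl) (sqr_sqrtr kk) !mulrA.
  have LL2 : 2 * (C * L) + 2 <= (2 * C + 3) * L.
    have -> : (2 * C + 3) * L = 2 * (C * L) + 3 * L by ring.
    by rewrite lerD2l.
  have [h1 h2] := chain_bounds _ _ w0 w1 e P (k * Delta) _ (C * L) ((2 * C + 3) * L)
    n1 conn (Pmat_tr e esym gamma Delta) (Pmat_const e gamma Delta eirr) c0
    (sqn_Pmat_decay e esym eirr gamma Delta gamma1 D0 deg_le)
    (estep_mgf e esym eirr gamma gamma1 m0) V0 (mulr_ge0 (ltW C0) L0) VL LL2 x0.
  by split=> [t|K1 s spec t ht]; rewrite /edge_prob edge_exp_chain; [exact: h1|exact: h2 ht].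
(* Here 2 is the time factor of [xi_flat] and [23 = 2 * 10 + 3], the 3 coming from [sqrt_ln_ge]. *)
exists 10, 2, 23; split=> //.
move=> n d e n0 esym eirr conn ereg x0 P.
have w0 := @vweight_ge0 R n d e; have w1 := @vweight_sum1 R n d e eirr ereg.
have [n1|n1] := leqP n 1.
  have [h1 h2] := chain_bounds_le1 _ (vstep e d) w0 w1
    (fun t x => maxdev x (xi P x0 t) <= 10 * d%:R ^+ 2 * Num.sqrt (ln n%:R)) x0 n0 n1.
  by split=> [t|/h2//]; rewrite /vertex_prob vertex_exp_chain; exact: h1.
have d_gt0 : (0 < d)%N by rewrite -(ereg (Ordinal n0)) connected_deg_gt0.
have d1 : 1 <= d%:R :> R by rewrite ler1n.
have d0 : 0 < d%:R :> R by exact: lt_le_trans d1.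
have deg_le u : (deg e u)%:R <= d%:R :> R by rewrite ereg.
have gamma1 : 1 < 1 + d%:R^-1 :> R by rewrite ltrDl invr_gt0.
have ln0 : 0 <= ln n%:R :> R by rewrite ln_ge0 // ler1n.
have c0 : 0 < (1 + d%:R^-1 - 1) / ((1 + d%:R^-1) ^+ 2 * d%:R) :> R.
  by rewrite divr_gt0 ?subr_gt0 // mulr_gt0 // exprn_gt0 // (lt_trans ltr01).
have q := sqrt_ln_ge n (1 : R) n1 (lexx 1); rewrite mul1r in q; set L := Num.sqrt (ln n%:R) in q *.
have L0 : 0 <= L := sqrtr_ge0 _.
have V0 : 0 < 2 * d%:R * d.+1%:R ^+ 2 :> R by rewrite !mulr_gt0 ?exprn_gt0.
have dL0 : 0 <= 10 * d%:R ^+ 2 * L by rewrite !mulr_ge0 // exprn_ge0.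
(* The constant 10 suffices because [24 d (d + 1)^2 <= 96 d^3 <= 100 d^4] for [d >= 1]. *)
have VL : 12 * (2 * d%:R * d.+1%:R ^+ 2) * ln n%:R <= (10 * d%:R ^+ 2 * L) ^+ 2.
  rewrite exprMn sqr_sqrtr // ler_wpM2r // -[d.+1%:R]natr1; move: d%:R d1 => r r1.
  have h : (r + 1) ^+ 2 <= 4 * r ^+ 2 by nra.
  have h1 : 24 * r * (r + 1) ^+ 2 <= 24 * r * (4 * r ^+ 2) by rewrite ler_wpM2l //; lra.
  have h2 : r ^+ 3 <= r ^+ 4 by rewrite ler_weXn2l.
  have h3 : 0 <= r ^+ 3 by rewrite exprn_ge0 //; lra.
  have -> : 12 * (2 * r * (r + 1) ^+ 2) = 24 * r * (r + 1) ^+ 2 by ring.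
  apply: le_trans h1 _.
  have -> : 24 * r * (4 * r ^+ 2) = 96 * r ^+ 3 by ring.
  have -> : (10 * r ^+ 2) ^+ 2 = 100 * r ^+ 4 by ring.
  lra.
have LL2 : 2 * (10 * d%:R ^+ 2 * L) + 2 <= 23 * d%:R ^+ 2 * L.
  have : 1 <= d%:R ^+ 2 :> R by rewrite exprn_ege1.
  by move: (_ ^+ 2) => r r1; nra.
have [h1 h2] := chain_bounds _ _ w0 w1 e P (2 * d%:R * d.+1%:R ^+ 2) _
  (10 * d%:R ^+ 2 * L) (23 * d%:R ^+ 2 * L)
  n1 conn (Pmat_tr e esym _ _) (Pmat_const e _ _ eirr) c0
  (sqn_Pmat_decay e esym eirr _ _ gamma1 d0 deg_le)
  (vstep_mgf d e esym eirr ereg d_gt0) V0 dL0 VL LL2 x0.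
by split=> [t|K1 s spec t ht]; rewrite /vertex_prob vertex_exp_chain; [exact: h1|exact: h2 ht].
Qed.
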